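(* Let $G$ and $H$ be finite simple graphs, each with at least one vertex. Then the join $G+H$ satisfies $p(G+H)=2$ and \[ P(G+H)=\alpha(G+H)+1=\max(\alpha(G),\alpha(H))+1. \]
   Context: The join $G+H$ has vertex set $V(G)\cup V(H)$ (disjoint) and edge set $E(G)\cup E(H)\cup\{gh : g\in V(G), h\in V(H)\}$. $\alpha(\cdot)$ denotes the independence number. A distribution of pegs on a graph $\Gamma$ is a subset $D \subseteq V(\Gamma)$. If $u,v \in D$ are distinct adjacent vertices and $w \notin D$ is a vertex adjacent to $v$, the pegging move (jumping $u$ over $v$ into $w$) replaces $D$ by $(D\setminus\{u,v\})\cup\{w\}$. A vertex $t$ is reachable from $D$ if some finite (possibly empty) sequence of pegging moves starting from $D$ ends in a distribution containing $t$; $\mathrm{Reach}(D)$ is the set of reachable vertices. The pegging number $P(\Gamma)$ (resp. optimal pegging number $p(\Gamma)$) is the smallest positive integer $d$ such that every (resp. some) distribution of size $d$ on $\Gamma$ has reach $V(\Gamma)$. *)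

(* Defs.v *)
From mathcomp Require Import all_boot.
Set Implicit Arguments.
Unset Strict Implicit.
Unset Printing Implicit Defensive.

Record sgraph := SGraph {
  vertex :> finType;
  adj : rel vertex;
  adj_sym : symmetric adj;
  adj_irrefl : irreflexive adj
}.

Section Join.
Variables G H : sgraph.

Definition join_adj : rel (vertex G + vertex H)%type := fun x y =>
  match x, y with
  | inl g, inl g' => adj g g'
  | inr h, inr h' => adj h h'
  | _, _ => true
  end.

Lemma join_adj_sym : symmetric join_adj.
Proof. by case=> [g|h] [g'|h'] //=; apply: adj_sym. Qed.

Lemma join_adj_irrefl : irreflexive join_adj.
Proof. by case=> [g|h] /=; apply: adj_irrefl. Qed.

Definition join : sgraph := SGraph join_adj_sym join_adj_irrefl.
End Join.

Section Pegging.
Variable G : sgraph.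

Definition independent (S : {set G}) : bool :=
  [forall x in S, forall y in S, ~~ adj x y].

Definition independence_number : nat := \max_(S : {set G} | independent S) #|S|.

Definition pegging_move : rel {set G} := fun D D' =>
  [exists u, exists v, exists w,
    [&& u \in D, v \in D, adj u v, w \notin D, adj v w
      & D' == w |: (D :\: [set u; v])]].

Definition reach (D : {set G}) : {set G} :=
  [set t | [exists D' : {set G}, connect pegging_move D D' && (t \in D')]].

Definition least_positive (Q : nat -> Prop) (d : nat) : Prop :=
  [/\ 0 < d, Q d & forall d', 0 < d' -> Q d' -> d <= d'].

Definition is_pegging_number : nat -> Prop :=
  least_positive (fun d => forall D : {set G}, #|D| = d -> reach D = [set: G]).

Definition is_optimal_pegging_number : nat -> Prop :=
  least_positive (fun d => exists D : {set G}, #|D| = d /\ reach D = [set: G]).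

(* The two predicates above are functional, so they determine P(G) and p(G).
   They are relations because p is undefined on the empty graph. *)
Lemma least_positive_uniq Q d1 d2 :
  least_positive Q d1 -> least_positive Q d2 -> d1 = d2.
Proof.
by case=> p1 q1 m1 [p2 q2 m2]; apply/eqP; rewrite eqn_leq m1 // m2.
Qed.
End Pegging.

(* Main.v *)
Require Import Defs.
From mathcomp Require Import all_boot.

Set Implicit Arguments.
Unset Strict Implicit.
Unset Printing Implicit Defensive.

(** An independent distribution admits no move, so its reach is itself; this
gives both lower bounds.  Conversely, a distribution with pegs on both sides
of a join reaches every vertex in at most one move, since a peg can jump over
one on the other side into any hole on its own side.  A distribution larger
than the independence number contains two adjacent pegs: if all pegs lie on
one side, jumping one of them to the other side leaves a peg on each side,
unless there were only two pegs, in which case the graph is complete. *)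

Section Reach.
Variable G : sgraph.
Implicit Types (D S : {set G}) (u v w t : G).

Lemma independentP S :
  reflect {in S &, forall x y, ~~ adj x y} (independent S).
Proof.
apply: (iffP forall_inP) => [h x y xS yS | h x xS].
  by move/forall_inP: (h x xS); apply.
by apply/forall_inP => y yS; apply: h.
Qed.

Lemma independent_card S : independent S -> #|S| <= independence_number G.
Proof. by move=> iS; apply: (leq_bigmax_cond (F := fun S => #|S|)). Qed.

Lemma independent_sub S D : D \subset S -> independent S -> independent D.
Proof.
move/subsetP=> sDS /independentP iS; apply/independentP => x y xD yD.
by apply: iS; apply: sDS.
Qed.

Lemma independent1 v : independent [set v].
Proof. by apply/independentP => x y /set1P-> /set1P->; rewrite adj_irrefl. Qed.

(** The empty set is independent, so the maximum ranges over a nonempty family and is attained. *)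
Lemma independence_number_witness :
  exists2 S : {set G}, independent S & #|S| = independence_number G.
Proof.
have i0 : independent (set0 : {set G}).
  by apply/independentP => x y; rewrite inE.
rewrite /independence_number (bigmax_eq_arg set0) //.
by case: arg_maxnP => // S iS _; exists S.
Qed.

Lemma dependent_adj D :
  ~~ independent D -> exists u v, [/\ u \in D, v \in D & adj u v].
Proof.
case/forall_inPn=> u uD /forall_inPn[v vD]; rewrite negbK => uv.
by exists u, v.
Qed.

Lemma reach_independent D : independent D -> reach D = D.
Proof.
move/independentP=> iD; apply/setP => t; rewrite inE.
apply/existsP/idP => [[D' /andP[/connectP[[|D1 p] /= pth ->] //]] | tD].
  (* A nonempty path would start with a move, which needs two adjacent pegs in [D]. *)
  case/andP: pth => /existsP[u /existsP[v /existsP[w]]] + _ _.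
  by case/and5P=> uD vD uv _ _; move: (iD u v uD vD); rewrite uv.
by exists D; rewrite connect0.
Qed.

Lemma mem_reach D t : t \in D -> t \in reach D.
Proof. by move=> tD; rewrite inE; apply/existsP; exists D; rewrite connect0. Qed.

Lemma reach_move D u v w t :
    u \in D -> v \in D -> w \notin D -> adj u v -> adj v w ->
  t \in reach (w |: (D :\: [set u; v])) -> t \in reach D.
Proof.
move=> uD vD wD uv vw; rewrite !inE => /existsP[D' /andP[cD' tD']].
apply/existsP; exists D'; rewrite tD' andbT.
apply: connect_trans cD'; apply: connect1.
apply/existsP; exists u; apply/existsP; exists v; apply/existsP; exists w.
by rewrite uD vD uv wD vw eqxx.
Qed.

Lemma reach_jump D u v w :
  u \in D -> v \in D -> w \notin D -> adj u v -> adj v w -> w \in reach D.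
Proof.
move=> uD vD wD uv vw; apply: (reach_move uD vD wD uv vw).
by apply: mem_reach; rewrite setU11.
Qed.

End Reach.

(* The two parts of a join are encoded by a colouring [s : G -> bool], so that
   they play symmetric roles. *)
Section TwoSided.
Variables (G : sgraph) (s : G -> bool).
Hypothesis adj_sides : forall x y : G, s x != s y -> adj x y.
Hypothesis side_inhabited : forall b, exists x : G, s x = b.
Implicit Type D : {set G}.

Lemma reach_two_sides D (x y : G) :
  x \in D -> y \in D -> s x != s y -> reach D = [set: G].
Proof.
move=> xD yD sxy; apply/setP => t; rewrite [RHS]inE.
have [tD|tD] := boolP (t \in D); first exact: mem_reach.
have [stx|stx] := eqVneq (s t) (s x).
  apply: (reach_jump xD yD tD); first exact: adj_sides.
  by apply: adj_sides; rewrite stx eq_sym.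
apply: (reach_jump yD xD tD); apply: adj_sides; first by rewrite eq_sym.
by rewrite eq_sym.
Qed.

Lemma reach_large D : independence_number G < #|D| -> reach D = [set: G].
Proof.
move=> ltD.
have /dependent_adj[u [v [uD vD uv]]] : ~~ independent D.
  by apply/negP => /independent_card; rewrite leqNgt ltD.
have [/existsP[z /andP[zD sz]]|/existsPn one_side] :=
  boolP [exists z, (z \in D) && (s z != s u)].
  exact: reach_two_sides zD uD sz.
have side z : z \in D -> s z = s u.
  by move=> zD; move: (one_side z); rewrite zD negbK => /eqP.
(* All pegs lie on the side of [u], so any [h] on the other side is a hole adjacent to [v], and [u]
   can jump over [v] into it. *)
have [h sh] := side_inhabited (~~ s u).
have hD : h \notin D by apply/negP => /side; rewrite sh; case: (s u).
have vh : adj v h by apply: adj_sides; rewrite sh (side v vD); case: (s u).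
apply/setP => t; rewrite [RHS]inE.
have [tD|tD] := boolP (t \in D); first exact: mem_reach.
(* A third peg [z] survives the jump into [h], leaving pegs on both sides. *)
have [D2|[z]] := set_0Vmem (D :\: [set u; v]); last first.
  rewrite inE => /andP[zuv zD]; apply: (reach_move uD vD hD uv vh).
  rewrite (@reach_two_sides _ h z) ?inE ?eqxx //.
    by move: zuv; rewrite !inE zD => ->; rewrite orbT.
  by rewrite sh (side z zD); case: (s u).
(* With only the pegs [u] and [v], jump [u] over [v] straight into [t]. If [v] and [t] were not
   adjacent, [[set v; t]] would be independent, forcing [D] to have more than two pegs. *)
apply: (reach_jump uD vD tD uv); apply/negPn/negP => vt.
have vNt : v != t by apply: contraNneq tD => <-.
have ivt : independent [set v; t].
  by apply/independentP => x y /set2P[]-> /set2P[]->;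
    rewrite ?adj_irrefl // adj_sym.
have := leq_ltn_trans (independent_card ivt) ltD.
rewrite cards2 vNt ltnNge => /negP[].
have /subset_leq_card /leq_trans-> // : D \subset [set u; v].
  by rewrite -setD_eq0 D2.
by rewrite cards2; case: (u != v).
Qed.

Lemma two_sided_optimal_pegging_number : is_optimal_pegging_number G 2.
Proof.
have [x sx] := side_inhabited true; have [y sy] := side_inhabited false.
have xy : x != y by apply: contra_eq_neq sx => ->; rewrite sy.
(* Only size 1 needs an argument for minimality: a single peg cannot move, yet there are two
   distinct vertices. *)
split=> // [|[//|[|//]] _ [D [/eqP/cards1P[z ->]]]].
  exists [set x; y]; split; first by rewrite cards2 xy.
  by apply: (@reach_two_sides _ x y); rewrite ?inE ?eqxx ?orbT ?sx ?sy.
rewrite reach_independent ?independent1 // => zT.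
have /set1P xz : x \in [set z] by rewrite zT inE.
have /set1P yz : y \in [set z] by rewrite zT inE.
by rewrite xz yz eqxx in xy.
Qed.

Lemma two_sided_pegging_number : is_pegging_number G (independence_number G + 1).
Proof.
rewrite addn1; split=> // [D cD | d _ Qd]; first by apply: reach_large; rewrite cD.
rewrite ltnNge; apply/negP => led.
have [S iS cS] := independence_number_witness G.
(* A maximum independent set [S] has subsets of every size [d] up to its own: they number a positive
   binomial coefficient. *)
have /set0Pn[D] : [set D : {set G} | D \subset S & #|D| == d] != set0.
  by rewrite -card_gt0 cards_draws bin_gt0 cS.
rewrite inE => /andP[sDS /eqP cD].
have iD := independent_sub sDS iS.
(* The stuck distribution [D] would have to be the whole vertex set, which contains adjacent
   vertices from opposite sides. *)
have DT : D = [set: G] by rewrite -(Qd D cD) reach_independent.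
have [x sx] := side_inhabited true; have [y sy] := side_inhabited false.
move/independentP: iD => /(_ x y); rewrite DT !inE => /(_ isT isT) /negP[].
by apply: adj_sides; rewrite sx sy.
Qed.

End TwoSided.

Lemma independent_imset (G K : sgraph) (f : G -> K) (S : {set G}) :
  (forall x y, adj (f x) (f y) = adj x y) -> independent S ->
  independent (f @: S).
Proof.
move=> fadj /independentP iS; apply/independentP.
by move=> _ _ /imsetP[x xS ->] /imsetP[y yS ->]; rewrite fadj; apply: iS.
Qed.

Lemma independent_preimset (G K : sgraph) (f : G -> K) (S : {set K}) :
  (forall x y, adj (f x) (f y) = adj x y) -> independent S ->
  independent (f @^-1: S).
Proof.
move=> fadj /independentP iS; apply/independentP => x y.
by rewrite !inE -fadj; apply: iS.
Qed.

Lemma independence_number_embed (G K : sgraph) (f : G -> K) :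
  injective f -> (forall x y, adj (f x) (f y) = adj x y) ->
  independence_number G <= independence_number K.
Proof.
move=> finj fadj; apply/bigmax_leqP => S iS; rewrite -(card_imset _ finj).
exact/independent_card/independent_imset.
Qed.

(** Pull [S] back along [f]: lying in the range of [f], it is covered by the image of its preimage,
    which is independent in [G]. *)
Lemma independent_card_image (G K : sgraph) (f : G -> K) (S : {set K}) :
  injective f -> (forall x y, adj (f x) (f y) = adj x y) ->
  independent S -> {subset S <= codom f} -> #|S| <= independence_number G.
Proof.
move=> finj fadj iS sSf.
apply: leq_trans (independent_card (independent_preimset fadj iS)).
rewrite -(card_imset _ finj); apply/subset_leq_card/subsetP => y yS.
have /codomP[x yx] := sSf y yS.
by rewrite yx imset_f // inE -yx.
Qed.

Lemma independence_number_join (G H : sgraph) :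
  independence_number (join G H) =
  maxn (independence_number G) (independence_number H).
Proof.
have inl_inj : injective (inl : G -> join G H) by move=> ? ? [].
have inr_inj : injective (inr : H -> join G H) by move=> ? ? [].
apply/eqP; rewrite eqn_leq geq_max.
rewrite (independence_number_embed inl_inj) //.
rewrite (independence_number_embed inr_inj) // !andbT.
apply/bigmax_leqP => S iS; rewrite leq_max.
(* An independent set of the join lies within one summand, since vertices of different summands are
   adjacent. *)
have [/existsP[g gS]|/existsPn noG] := boolP [exists g : G, inl g \in S].
  rewrite (independent_card_image inl_inj _ iS) //.
  case=> [g' _|h hS]; first exact: codom_f.
  by move/independentP: iS => /(_ _ _ gS hS).
rewrite (independent_card_image inr_inj _ iS) ?orbT //.
by case=> [g gS|h _]; [move: (noG g); rewrite gS | exact: codom_f].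
Qed.

Theorem theorem3p6 (G H : sgraph) (hG : 0 < #|G|) (hH : 0 < #|H|) :
  [/\ is_optimal_pegging_number (join G H) 2,
      is_pegging_number (join G H) (independence_number (join G H) + 1)
    & independence_number (join G H) + 1 =
        maxn (independence_number G) (independence_number H) + 1].
Proof.
(* The colour of a vertex is its summand; both colours occur because [G] and [H] are nonempty. *)
pose s (x : join G H) := if x is inl _ then true else false.
have adj_s (x y : join G H) : s x != s y -> adj x y by case: x y => [?|?] [].
have inh b : exists x : join G H, s x = b.
  case/card_gt0P: hG => g _; case/card_gt0P: hH => h _.
  by case: b; [exists (inl g) | exists (inr h)].
split; last by rewrite independence_number_join.
  exact: two_sided_optimal_pegging_number adj_s inh.
exact: two_sided_pegging_number adj_s inh.
Qed.
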